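(* Let $H=H_0+H_{\rm int}$ with $H_0,H_{\rm int}\in\mathbb C^{d\times d}$ Hermitian. Let $\lambda^{(0)}_0\le\dots\le\lambda^{(0)}_{d-1}$ be the eigenvalues of $H_0$ with orthonormal eigenvectors $\ket{\phi^{(0)}_0},\dots,\ket{\phi^{(0)}_{d-1}}$, and for $j\in\{0,\dots,d-1\}$ let $\gamma^{(0)}_j:=\min\{|\lambda^{(0)}_j-\lambda^{(0)}_{j-1}|,|\lambda^{(0)}_j-\lambda^{(0)}_{j+1}|\}$ with $\lambda^{(0)}_{-1}:=-\infty$, $\lambda^{(0)}_d:=\infty$. Let $0<t\le\frac{1}{4\|H\|}$ and $0\le\epsilon\le\|H_{\rm int}\|$, and let $\widetilde U$ be a unitary with $\|\widetilde U-e^{-iHt}\|\le\frac{t\epsilon}{9}$ (and $\frac{t\epsilon}{9}\le\frac13$). Let $\widetilde\lambda_0\le\dots\le\widetilde\lambda_{d-1}$ be the eigenvalues of the effective Hamiltonian $\widetilde H=\frac it\log\widetilde U$ with eigenvectors $\ket{\widetilde\phi_0},\dots,\ket{\widetilde\phi_{d-1}}$. If $\gamma^{(0)}_j>2\|H_{\rm int}\|$, then $$|\langle\widetilde\phi_j|\phi^{(0)}_j\rangle|^2\ge 1-\frac{\pi\|H_{\rm int}\|}{\gamma^{(0)}_j-2\|H_{\rm int}\|}.$$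
   Context: $\|\cdot\|$ is the spectral norm. For a matrix $M$ with $\|M-\mathbb 1\|<1$, $\log M:=\sum_{k=1}^\infty\frac{(-1)^{k+1}}{k}(M-\mathbb 1)^k$; under the hypotheses this converges and the effective Hamiltonian $\widetilde H=\frac it\log\widetilde U$ is Hermitian. *)

(* Defs.v *)
(* R : realType, complex numbers R[i] from mathcomp-real-closed. *)
From mathcomp Require Import all_boot all_order all_algebra.
From mathcomp Require Import all_classical all_reals all_analysis.
From mathcomp Require Export complex.
Set Implicit Arguments. Unset Strict Implicit. Unset Printing Implicit Defensive.
Import Order.TTheory GRing.Theory Num.Theory.
Local Open Scope ring_scope.
Local Open Scope complex_scope.

Section Defs.
Variable R : realType.
Local Notation C := R[i].

(* squared modulus |z|^2 of a complex number, as a real *)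
Definition q_cmod2 (z : C) : R := complex.Re z ^+ 2 + complex.Im z ^+ 2.

(* conjugate transpose *)
Definition q_adj {m n : nat} (A : 'M[C]_(m, n)) : 'M[C]_(n, m) :=
  map_mx (fun z : C => z^*) A^T.

(* Hermitian inner product <u|v> = sum_i conj(u_i) v_i *)
Definition q_cdot {d : nat} (u v : 'cV[C]_d) : C := \sum_i (u i 0)^* * v i 0.

(* Euclidean norm of a vector *)
Definition q_vnorm {d : nat} (v : 'cV[C]_d) : R := Num.sqrt (\sum_i q_cmod2 (v i 0)).

(* spectral (operator) norm: sup { |A v| : |v| <= 1 } *)
Definition q_opnorm {d : nat} (A : 'M[C]_d) : R :=
  sup [set q_vnorm (A *m v) | v in [set v : 'cV[C]_d | q_vnorm v <= 1]]%classic.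

Definition q_hermitian {d : nat} (A : 'M[C]_d) : Prop := q_adj A = A.
Definition q_unitary {d : nat} (U : 'M[C]_d) : Prop := q_adj U *m U = 1%:M.

(* the matrix series sum_{k>=0} a k converges (in operator norm) to L *)
Definition q_mx_series_to {d : nat} (a : nat -> 'M[C]_d) (L : 'M[C]_d) : Prop :=
  forall e : R, 0 < e -> exists N : nat, forall n : nat, (N <= n)%N ->
    q_opnorm (\sum_(k < n) a k - L) < e.

(* E = exp(M) = sum_k M^k / k! *)
Definition q_is_expm {d : nat} (M E : 'M[C]_d) : Prop :=
  q_mx_series_to (fun k => ((k`!)%:R : C)^-1 *: M ^+ k) E.

(* L = log(M) = sum_{k>=1} (-1)^(k+1)/k (M - 1)^k  (reindexed from 0) *)
Definition q_is_logm {d : nat} (M L : 'M[C]_d) : Prop :=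
  q_mx_series_to (fun k => ((-1) ^+ k / (k.+1)%:R : C) *: (M - 1%:M) ^+ k.+1) L.

(* v_0,...,v_{d-1} q_orthonormal *)
Definition q_orthonormal {d : nat} (v : 'I_d -> 'cV[C]_d) : Prop :=
  forall i j : 'I_d, q_cdot (v i) (v j) = (i == j)%:R.

(* (lam, phi) is an eigen-decomposition of A: q_orthonormal eigenvectors phi_j
   with real eigenvalues lam_j listed in nondecreasing order *)
Definition q_sorted_eigendecomp {d : nat} (A : 'M[C]_d) (lam : 'I_d -> R)
    (phi : 'I_d -> 'cV[C]_d) : Prop :=
  [/\ forall i j : 'I_d, (i <= j)%N -> lam i <= lam j,
      q_orthonormal phi &
      forall j : 'I_d, A *m phi j = (lam j)%:C *: phi j].

(* spectral q_gap gamma_j = min(|lam_j - lam_{j-1}|, |lam_j - lam_{j+1}|),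
   with lam_{-1} = -oo, lam_d = +oo (extended real) *)
Definition q_gap {d : nat} (lam : 'I_d -> R) (j : 'I_d) : \bar R :=
  let dist (o : option 'I_d) : \bar R :=
    if o is Some i then (`|lam j - lam i|)%:E else +oo%E in
  let left : \bar R := if (0 < val j)%N then dist (insub (val j).-1) else +oo%E in
  let right : \bar R := dist (insub (val j).+1) in
  Order.min left right.

End Defs.

(* Main.v *)
(* Let h be the norm of Hint. Telescoping powers shows that the logarithmic
   series is 3-Lipschitz on the ball of radius 2/3 around the identity, and on
   exp(-iHt) that series sums to -iHt because the eigenvalues of Ht lie in
   [-1/4, 1/4]. Hence the effective Hamiltonian is within eps/3 <= h of H, and
   within 2h of H0.

   By Weyl's inequality the j-th eigenvalue mu of the effective Hamiltonian is
   within 2h of the j-th eigenvalue of H0, hence at distance at least g - 2h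
   from all the others. The residual (H0 - mu) v of its eigenvector v has norm
   at most 2h, so the weight w of v off the j-th eigenvector of H0 satisfies
   (g - 2h)^2 w <= (2h)^2. With x = h / (g - 2h) this gives w <= min(1, 4x^2),
   which is at most pi x: use 4x^2 if x <= pi/4, and 1 otherwise. *)
Require Import Defs.
From mathcomp Require Import all_boot all_order all_algebra.
From mathcomp Require Import all_classical all_reals all_analysis.
From mathcomp Require Import complex ring lra.
Import Order.TTheory GRing.Theory Num.Theory.
Local Open Scope ring_scope.
Local Open Scope complex_scope.

Import Normc.

(** * Hermitian inner product, orthonormal bases and operator bounds *)

Section HermitianGeometry.
Set Implicit Arguments.
Unset Strict Implicit.
Context {R : realType}.
Local Notation C := R[i].
Implicit Types (d : nat) (z : C).

Lemma cmod2_ge0 z : 0 <= q_cmod2 z.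
Proof. by rewrite /q_cmod2 addr_ge0 ?sqr_ge0. Qed.

Lemma normc_ge0 z : 0 <= normc z.
Proof. by case: z => a b; exact: sqrtr_ge0. Qed.

Lemma sqr_normc_cmod2 z : normc z ^+ 2 = q_cmod2 z.
Proof. by case: z => a b; rewrite /= sqr_sqrtr // addr_ge0 ?sqr_ge0. Qed.

Lemma normc_real (x : R) : normc x%:C = `|x|.
Proof. by rewrite /= expr0n addr0 sqrtr_sqr. Qed.

Lemma cmod2M z1 z2 : q_cmod2 (z1 * z2) = q_cmod2 z1 * q_cmod2 z2.
Proof. by rewrite -!sqr_normc_cmod2 normcM exprMn. Qed.

Lemma cmod2_conj z : q_cmod2 z^* = q_cmod2 z.
Proof. by case: z => a b; rewrite /q_cmod2 /= sqrrN. Qed.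

Lemma cmod2_mulJ z : (q_cmod2 z)%:C = z^* * z.
Proof. by case: z => a b; rewrite /q_cmod2; simpc; congr (_ +i* _); ring. Qed.

Lemma conj_real (x : R) : Num.conj x%:C = x%:C :> C.
Proof. exact: conjc_real. Qed.

Lemma normcX z n : normc (z ^+ n) = normc z ^+ n.
Proof. by elim: n => [|n IH]; rewrite ?normc1 // !exprS normcM IH. Qed.

Lemma normc_nat n : normc (n%:R : C) = n%:R.
Proof. by rewrite -(rmorph_nat (real_complex R)) normc_real ger0_norm. Qed.

Lemma vnorm_ge0 d (v : 'cV[C]_d) : 0 <= q_vnorm v.
Proof. exact: sqrtr_ge0. Qed.

Lemma sqr_vnorm d (v : 'cV[C]_d) : q_vnorm v ^+ 2 = \sum_i q_cmod2 (v i 0).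
Proof. by rewrite sqr_sqrtr // sumr_ge0 // => i _; exact: cmod2_ge0. Qed.

Lemma cdot_vnorm d (v : 'cV[C]_d) : q_cdot v v = (q_vnorm v ^+ 2)%:C.
Proof. by rewrite sqr_vnorm rmorph_sum; apply: eq_bigr => i _; rewrite /= cmod2_mulJ. Qed.

Lemma cdotC d (u v : 'cV[C]_d) : (q_cdot u v)^* = q_cdot v u.
Proof.
rewrite /q_cdot rmorph_sum; apply: eq_bigr => i _ /=.
by rewrite rmorphM /= conjcK mulrC.
Qed.

Lemma cdotDr d (u v w : 'cV[C]_d) : q_cdot u (v + w) = q_cdot u v + q_cdot u w.
Proof. by rewrite /q_cdot -big_split; apply: eq_bigr => i _ /=; rewrite mxE mulrDr. Qed.

Lemma cdotZr d (u v : 'cV[C]_d) (a : C) : q_cdot u (a *: v) = a * q_cdot u v.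
Proof. by rewrite /q_cdot mulr_sumr; apply: eq_bigr => i _ /=; rewrite mxE mulrCA. Qed.

Lemma cdotZl d (u v : 'cV[C]_d) (a : C) : q_cdot (a *: u) v = a^* * q_cdot u v.
Proof. by rewrite -cdotC cdotZr rmorphM /= cdotC. Qed.

Lemma cdotDl d (u v w : 'cV[C]_d) : q_cdot (u + v) w = q_cdot u w + q_cdot v w.
Proof. by rewrite -cdotC cdotDr rmorphD /= !cdotC. Qed.

Lemma cdot_sumr d (I : finType) (u : 'cV[C]_d) (F : I -> 'cV[C]_d) :
  q_cdot u (\sum_i F i) = \sum_i q_cdot u (F i).
Proof.
rewrite /q_cdot exchange_big /=; apply: eq_bigr => i _.
by rewrite summxE mulr_sumr.
Qed.

Lemma sqr_vnormE d (v : 'cV[C]_d) : q_vnorm v ^+ 2 = complex.Re (q_cdot v v).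
Proof. by rewrite cdot_vnorm. Qed.

Lemma Re_cdotC d (u v : 'cV[C]_d) :
  complex.Re (q_cdot u v) = complex.Re (q_cdot v u).
Proof. by rewrite -cdotC; case: (q_cdot v u). Qed.

Lemma sqr_vnormD d (u v : 'cV[C]_d) :
  q_vnorm (u + v) ^+ 2 =
  q_vnorm u ^+ 2 + 2 * complex.Re (q_cdot u v) + q_vnorm v ^+ 2.
Proof.
rewrite !sqr_vnormE cdotDr !cdotDl.
have := Re_cdotC u v.
case: (q_cdot u u) (q_cdot v u) (q_cdot u v) (q_cdot v v) => [? ?] [? ?] [? ?] [? ?] /=.
by move=> ->; ring.
Qed.

Lemma vnorm0 d : q_vnorm (0 : 'cV[C]_d) = 0.
Proof.
by rewrite /q_vnorm big1 ?sqrtr0 // => i _; rewrite mxE /q_cmod2 /= expr0n addr0.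
Qed.

Lemma vnormZ d (a : C) (v : 'cV[C]_d) : q_vnorm (a *: v) = normc a * q_vnorm v.
Proof.
apply/eqP; rewrite -(@eqrXn2 _ 2) ?mulr_ge0 ?vnorm_ge0 ?normc_ge0 //; apply/eqP.
rewrite exprMn !sqr_vnorm sqr_normc_cmod2 mulr_sumr.
by apply: eq_bigr => i _; rewrite mxE cmod2M.
Qed.

Lemma vnormN d (v : 'cV[C]_d) : q_vnorm (- v) = q_vnorm v.
Proof. by rewrite -scaleN1r vnormZ normcN normc1 mul1r. Qed.

Lemma vnorm_eq0 d (v : 'cV[C]_d) : q_vnorm v = 0 -> v = 0.
Proof.
move=> v0; have /eqP := sqr_vnorm v; rewrite v0 expr0n /= eq_sym.
rewrite psumr_eq0 => [/allP h|i _]; last exact: cmod2_ge0.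
apply/matrixP => i j; rewrite ord1 mxE; apply: eq0_normc.
have /eqP := h i (mem_index_enum i).
by rewrite -sqr_normc_cmod2 => /eqP; rewrite sqrf_eq0 => /eqP.
Qed.

(** Cauchy-Schwarz for the real part: with a = |u| and b = |v|, expanding |b u - a v|^2 >= 0 gives 2
    a b Re<u|v> <= 2 a^2 b^2, and a b cancels unless a vector is zero. *)
Lemma Re_cdot_le d (u v : 'cV[C]_d) :
  complex.Re (q_cdot u v) <= q_vnorm u * q_vnorm v.
Proof.
have [/vnorm_eq0 ->|u0] := eqVneq (q_vnorm u) 0.
  rewrite vnorm0 mul0r /q_cdot big1 // => i _.
  by rewrite mxE rmorph0 mul0r.
have [/vnorm_eq0 ->|v0] := eqVneq (q_vnorm v) 0.
  by rewrite vnorm0 mulr0 /q_cdot big1 // => i _; rewrite mxE mulr0.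
set a := q_vnorm u; set b := q_vnorm v.
have a_gt0 : 0 < a by rewrite lt_def u0 vnorm_ge0.
have b_gt0 : 0 < b by rewrite lt_def v0 vnorm_ge0.
have := sqr_ge0 (q_vnorm (b%:C *: u + (- a)%:C *: v)).
rewrite sqr_vnormD !vnormZ !normc_real cdotZr cdotZl conj_real mulrA -rmorphM.
rewrite (_ : complex.Re (_%:C * _) = - a * b * complex.Re (q_cdot u v)); last first.
  by case: (q_cdot u v) => x y /=; rewrite mul0r subr0.
rewrite normrN !ger0_norm ?vnorm_ge0 // -/a -/b.
move=> h; rewrite -(ler_pM2l (mulr_gt0 a_gt0 b_gt0)).
lra.
Qed.

Lemma vnormD d (u v : 'cV[C]_d) : q_vnorm (u + v) <= q_vnorm u + q_vnorm v.
Proof.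
rewrite -(@ler_pXn2r _ 2) ?nnegrE ?addr_ge0 ?vnorm_ge0 // sqr_vnormD.
have := Re_cdot_le u v; rewrite sqrrD; lra.
Qed.

Lemma vnormB d (u v : 'cV[C]_d) : q_vnorm (u - v) <= q_vnorm u + q_vnorm v.
Proof. by rewrite -(vnormN v) vnormD. Qed.

Lemma vnorm_sum d (I : Type) (r : seq I) (P : pred I) (F : I -> 'cV[C]_d) :
  q_vnorm (\sum_(i <- r | P i) F i) <= \sum_(i <- r | P i) q_vnorm (F i).
Proof.
apply: (big_ind2 (fun x y => q_vnorm x <= y)); first by rewrite vnorm0.
- by move=> x1 x2 y1 y2 h1 h2; apply: le_trans (vnormD _ _) (lerD h1 h2).
- by [].
Qed.

Section OrthonormalBasis.
Variables (d : nat) (psi : 'I_d -> 'cV[C]_d).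
Hypothesis psi_on : q_orthonormal psi.

Lemma vnorm_orthonormal k : q_vnorm (psi k) = 1.
Proof.
apply/eqP; rewrite -(@eqrXn2 _ 2) ?vnorm_ge0 // expr1n sqr_vnormE psi_on eqxx.
by [].
Qed.

(** Completeness comes from squareness: the matrix [P] with columns [psi k] satisfies P^* P = 1,
    hence also P P^* = 1, and the latter applied to [v] is the expansion. *)
Lemma orthonormal_expansion (v : 'cV[C]_d) :
  v = \sum_k q_cdot (psi k) v *: psi k.
Proof.
pose P := \matrix_(i, k) psi k i 0 : 'M[C]_d.
have PP : q_adj P *m P = 1%:M.
  apply/matrixP => i k; rewrite !mxE -(psi_on i k) /q_cdot.
  by apply: eq_bigr => l _; rewrite !mxE.
have /(congr1 (mulmx^~ v)) := mulmx1C PP; rewrite mul1mx -mulmxA => {1}<-.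
apply/matrixP => i j; rewrite ord1 mxE summxE; apply: eq_bigr => k _.
rewrite !mxE mulrC; congr (_ * _); rewrite /q_cdot.
by apply: eq_bigr => l _; rewrite !mxE.
Qed.

Lemma cdot_orthonormal_sum (a : 'I_d -> C) k :
  q_cdot (psi k) (\sum_l a l *: psi l) = a k.
Proof.
rewrite cdot_sumr (bigD1 k) //= cdotZr psi_on eqxx mulr1 big1 ?addr0 // => l lk.
by rewrite cdotZr psi_on eq_sym (negbTE lk) mulr0.
Qed.

Lemma sqr_vnorm_orthonormal_sum (a : 'I_d -> C) :
  q_vnorm (\sum_k a k *: psi k) ^+ 2 = \sum_k q_cmod2 (a k).
Proof.
apply: complexI; rewrite -cdot_vnorm cdot_sumr rmorph_sum /=.
apply: eq_bigr => k _.
by rewrite cdotZr -cdotC cdot_orthonormal_sum cmod2_mulJ mulrC.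
Qed.

Lemma parseval (v : 'cV[C]_d) :
  q_vnorm v ^+ 2 = \sum_k q_cmod2 (q_cdot (psi k) v).
Proof. by rewrite {1}(orthonormal_expansion v) sqr_vnorm_orthonormal_sum. Qed.

Lemma mulmx_eigenbasis (A : 'M[C]_d) (a : 'I_d -> C) (v : 'cV[C]_d) :
  (forall k, A *m psi k = a k *: psi k) ->
  A *m v = \sum_k (a k * q_cdot (psi k) v) *: psi k.
Proof.
move=> Apsi; rewrite {1}(orthonormal_expansion v) mulmx_sumr.
by apply: eq_bigr => k _; rewrite -scalemxAr Apsi scalerA mulrC.
Qed.

End OrthonormalBasis.

(** A bound on the operator norm without the supremum. Such bounds add, multiply and pass to limits
    directly, so [q_opnorm] only enters through [bounded_by_opnorm]. *)
Definition bounded_by d (A : 'M[C]_d) (c : R) : Prop :=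
  forall v, q_vnorm (A *m v) <= c * q_vnorm v.

(** The sum of the column norms is a crude bound, but any bound suffices to make the supremum in
    [q_opnorm] a true least upper bound rather than a default value. *)
Lemma bounded_by_exists d (A : 'M[C]_d) : exists c, bounded_by A c.
Proof.
exists (\sum_k q_vnorm (col k A)) => v.
have -> : A *m v = \sum_k v k 0 *: col k A.
  apply/matrixP => i j; rewrite ord1 mxE summxE; apply: eq_bigr => k _.
  by rewrite !mxE mulrC.
apply: le_trans (vnorm_sum _ _ _) _; rewrite mulr_suml; apply: ler_sum => k _.
rewrite vnormZ mulrC ler_wpM2l ?vnorm_ge0 //.
rewrite -(@ler_pXn2r _ 2) ?nnegrE ?vnorm_ge0 ?normc_ge0 // sqr_normc_cmod2 sqr_vnorm.
by rewrite (bigD1 k) //= lerDl sumr_ge0 // => i _; exact: cmod2_ge0.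
Qed.

Lemma opnorm_ub d (A : 'M[C]_d) (v : 'cV[C]_d) :
  q_vnorm v <= 1 -> q_vnorm (A *m v) <= q_opnorm A.
Proof.
move=> v1; apply: sup_upper_bound; last by exists v.
split; first by exists (q_vnorm (A *m v)); exists v.
have [c Ac] := bounded_by_exists A.
exists `|c| => _ [u /= u1 <-].
apply: le_trans (Ac u) _; apply: le_trans (ler_norm _) _.
by rewrite normrM [X in _ * X]ger0_norm ?vnorm_ge0 // ler_piMr.
Qed.

Lemma bounded_by_opnorm d (A : 'M[C]_d) : bounded_by A (q_opnorm A).
Proof.
move=> v; have [/vnorm_eq0 ->|v0] := eqVneq (q_vnorm v) 0.
  by rewrite mulmx0 vnorm0 mulr0.
pose w := (q_vnorm v)^-1%:C *: v.
have w1 : q_vnorm w = 1.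
  by rewrite vnormZ normc_real ger0_norm ?invr_ge0 ?vnorm_ge0 // mulVf.
have -> : A *m v = (q_vnorm v)%:C *: (A *m w).
  by rewrite /w -scalemxAr scalerA -rmorphM mulfV // scale1r.
rewrite vnormZ normc_real ger0_norm ?vnorm_ge0 // mulrC ler_wpM2r ?vnorm_ge0 //.
by apply: opnorm_ub; rewrite w1.
Qed.

Lemma opnorm_ge0 d (A : 'M[C]_d) : 0 <= q_opnorm A.
Proof.
by have := @opnorm_ub d A 0; rewrite mulmx0 vnorm0; apply.
Qed.

Lemma bounded_byW d (A : 'M[C]_d) a b : a <= b -> bounded_by A a -> bounded_by A b.
Proof. by move=> ab Aa v; apply: le_trans (Aa v) _; rewrite ler_wpM2r ?vnorm_ge0. Qed.

Lemma bounded_byD d (A B : 'M[C]_d) a b :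
  bounded_by A a -> bounded_by B b -> bounded_by (A + B) (a + b).
Proof.
by move=> Aa Bb v; rewrite mulmxDl mulrDl (le_trans (vnormD _ _)) ?lerD.
Qed.

Lemma bounded_byZ d (A : 'M[C]_d) a (z : C) :
  bounded_by A a -> bounded_by (z *: A) (normc z * a).
Proof. by move=> Aa v; rewrite -scalemxAl vnormZ -mulrA ler_wpM2l ?normc_ge0. Qed.

Lemma bounded_byN d (A : 'M[C]_d) a : bounded_by A a -> bounded_by (- A) a.
Proof. by move=> Aa v; rewrite mulNmx vnormN. Qed.

Lemma bounded_byM d (A B : 'M[C]_d) a b : 0 <= a ->
  bounded_by A a -> bounded_by B b -> bounded_by (A *m B) (a * b).
Proof.
move=> a0 Aa Bb v; rewrite -mulmxA (le_trans (Aa _)) // -mulrA ler_wpM2l //.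
Qed.

Lemma bounded_by1 d : bounded_by (1%:M : 'M[C]_d) 1.
Proof. by move=> v; rewrite mul1mx mul1r. Qed.

Lemma bounded_byX d (A : 'M[C]_d) a n : 0 <= a ->
  bounded_by A a -> bounded_by (A ^+ n) (a ^+ n).
Proof.
move=> a0 Aa; elim: n => [|n IH]; first exact: bounded_by1.
by rewrite !exprS; apply: bounded_byM.
Qed.

Lemma bounded_by_sum d n (F : 'I_n -> 'M[C]_d) (f : 'I_n -> R) :
  (forall k, bounded_by (F k) (f k)) -> bounded_by (\sum_k F k) (\sum_k f k).
Proof.
move=> Ff; apply: (big_ind2 (@bounded_by d)) => //.
  by move=> v; rewrite mul0mx vnorm0 mul0r.
by move=> *; apply: bounded_byD.
Qed.

(** Telescoping for matrices that may fail to commute: X^(n+2) - Y^(n+2) = X (X^(n+1) - Y^(n+1)) +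
    (X - Y) Y^(n+1). The factor n+1 later cancels the denominator of the logarithmic series. *)
Lemma bounded_by_subX d (X Y : 'M[C]_d) r e n : 0 <= r -> 0 <= e ->
  bounded_by X r -> bounded_by Y r -> bounded_by (X - Y) e ->
  bounded_by (X ^+ n.+1 - Y ^+ n.+1) (n.+1%:R * (r ^+ n * e)).
Proof.
move=> r0 e0 Xr Yr XY; elim: n => [|n IH]; first by rewrite !expr1 expr0 !mul1r.
have -> : X ^+ n.+2 - Y ^+ n.+2 =
    X *m (X ^+ n.+1 - Y ^+ n.+1) + (X - Y) *m Y ^+ n.+1.
  by rewrite mulmxBr mulmxBl !(exprS _ n.+1) addrA subrK.
have -> : n.+2%:R * (r ^+ n.+1 * e) =
    r * (n.+1%:R * (r ^+ n * e)) + e * r ^+ n.+1.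
  by rewrite -(natr1 n.+1) exprS; ring.
by apply: bounded_byD; apply: bounded_byM => //; apply: bounded_byX.
Qed.

End HermitianGeometry.

(** * Perturbation of eigenvalues and eigenvectors of Hermitian matrices *)

Section EigenvaluePerturbation.
Set Implicit Arguments.
Unset Strict Implicit.
Context {R : realType}.
Local Notation C := R[i].
Implicit Types (d : nat).

(** The spectral theorem gives A = P^-1 D P with P unitary and D real diagonal, so the eigenvectors
    are the columns of P^*. This basis later diagonalizes the exponential of [H] and its logarithmic
    sums. *)
Lemma hermitian_eigenbasis d (A : 'M[C]_d) : q_hermitian A ->
  exists (a : 'I_d -> R) (psi : 'I_d -> 'cV[C]_d),
    q_orthonormal psi /\ forall k, A *m psi k = (a k)%:C *: psi k.
Proof.
move=> hA.
have sA : A \is hermsymmx.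
  by apply/is_hermitianmxP; rewrite expr0 scale1r; exact/esym.
set P := spectralmx A; set D := spectral_diag A.
have P_unit := spectral_unitarymx A; rewrite -/P in P_unit.
have PP := unitarymxP P_unit.
have := orthomx_spectralP (hermitian_normalmx sA); rewrite -/P -/D => eA.
have real_D := hermitian_spectral_diag_real sA; rewrite -/D in real_D.
exists (fun k => complex.Re (D 0 k)), (fun k => col k (q_adj P)).
split=> [i k|k].
  have /matrixP /(_ i k) := PP; rewrite !mxE => <-; rewrite /q_cdot.
  by apply: eq_bigr => l _; rewrite !mxE conjCK.
have Dk : (complex.Re (D 0 k))%:C = D 0 k.
  by apply: RRe_real; move/mxOverP: real_D; apply.
have AP : A *m q_adj P = q_adj P *m diag_mx D.
  have -> : q_adj P = invmx P by rewrite invmx_unitary // /q_adj.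
  by rewrite {1}eA mulmxK // unitarymx_unit.
have -> : A *m col k (q_adj P) = col k (A *m q_adj P).
  by apply/matrixP => i l; rewrite !mxE; apply: eq_bigr => m _; rewrite !mxE.
rewrite AP mul_mx_diag; apply/matrixP => i l.
by rewrite !mxE Dk mulrC.
Qed.

Lemma Re_cdot_eigenbasis d (A : 'M[C]_d) (a : 'I_d -> R) psi v :
  q_orthonormal psi -> (forall k, A *m psi k = (a k)%:C *: psi k) ->
  complex.Re (q_cdot v (A *m v)) = \sum_k a k * q_cmod2 (q_cdot (psi k) v).
Proof.
move=> psi_on Apsi; rewrite (mulmx_eigenbasis psi_on v Apsi) cdot_sumr.
rewrite -[RHS]/(complex.Re (_%:C)) rmorph_sum; congr complex.Re.
apply: eq_bigr => k _.
by rewrite cdotZr rmorphM /= cmod2_mulJ -[q_cdot v _]cdotC -mulrA [_^* * _]mulrC.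
Qed.

(** A nonzero vector orthogonal to [phi k] for k < j and to [psi k] for k > j has Rayleigh quotient
    at least [lam j] for [A] and at most [mu j] for [B]; the two quotients differ by at most
    [eta]. *)
Lemma weyl_le d (A B : 'M[C]_d) lam mu phi psi eta j :
  q_sorted_eigendecomp A lam phi -> q_sorted_eigendecomp B mu psi ->
  bounded_by (A - B) eta -> lam j <= mu j + eta.
Proof.
move=> [lam_le phi_on Aphi] [mu_le psi_on Bpsi] AB.
(* [d] linear conditions, the [j]-th of which is void, so a nonzero [v] exists *)
pose l (k : 'I_d) := if (k < j)%N then phi k else if (j < k)%N then psi k else 0.
pose W := \matrix_(i, k) (l k i 0)^* : 'M[C]_d.
have /eqP/det0P[w w0 wW] : \det W = 0.
  rewrite (expand_det_col _ j) big1 // => i _.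
  by rewrite mxE /l !ltnn mxE rmorph0 mul0r.
pose v := w^T.
have v0 : q_vnorm v != 0.
  apply: contra w0 => /eqP /vnorm_eq0 v0.
  by apply/eqP/matrixP => a b; have /matrixP /(_ b a) := v0; rewrite !mxE.
have lv k : q_cdot (l k) v = 0.
  have /matrixP /(_ 0 k) := wW; rewrite !mxE => <-.
  by apply: eq_bigr => i _; rewrite !mxE mulrC.
have v_gt0 : 0 < q_vnorm v ^+ 2 by rewrite exprn_gt0 // lt_def v0 vnorm_ge0.
have hA : lam j * q_vnorm v ^+ 2 <= complex.Re (q_cdot v (A *m v)).
  rewrite (Re_cdot_eigenbasis v phi_on Aphi) (parseval phi_on) mulr_sumr.
  apply: ler_sum => k _; have [kj|jk] := ltnP k j.
    by have := lv k; rewrite /l kj => ->; rewrite /q_cmod2 /= expr0n addr0 !mulr0.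
  by rewrite ler_wpM2r ?cmod2_ge0 ?lam_le.
have hB : complex.Re (q_cdot v (B *m v)) <= mu j * q_vnorm v ^+ 2.
  rewrite (Re_cdot_eigenbasis v psi_on Bpsi) (parseval psi_on) mulr_sumr.
  apply: ler_sum => k _; have [kj|jk] := leqP k j.
    by rewrite ler_wpM2r ?cmod2_ge0 ?mu_le.
  have := lv k; rewrite /l ltnNge (ltnW jk) /= jk => ->.
  by rewrite /q_cmod2 /= expr0n addr0 !mulr0.
have hAB : complex.Re (q_cdot v (A *m v)) - complex.Re (q_cdot v (B *m v))
    <= eta * q_vnorm v ^+ 2.
  have -> : complex.Re (q_cdot v (A *m v)) - complex.Re (q_cdot v (B *m v)) =
      complex.Re (q_cdot v ((A - B) *m v)).
    rewrite mulmxBl cdotDr -[- (B *m v)]scaleN1r cdotZr mulN1r.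
    by case: (q_cdot v (A *m v)) (q_cdot v (B *m v)) => [? ?] [? ?].
  apply: le_trans (Re_cdot_le _ _) _.
  by rewrite expr2 mulrA [X in _ <= X]mulrC ler_wpM2l ?vnorm_ge0.
by rewrite -(ler_pM2r v_gt0) mulrDl; lra.
Qed.

Lemma weyl d (A B : 'M[C]_d) lam mu phi psi eta j :
  q_sorted_eigendecomp A lam phi -> q_sorted_eigendecomp B mu psi ->
  bounded_by (A - B) eta -> `|lam j - mu j| <= eta.
Proof.
move=> hA hB AB; have BA : bounded_by (B - A) eta.
  by rewrite -opprB; apply: bounded_byN.
have := weyl_le j hA hB AB; have := weyl_le j hB hA BA.
by rewrite ler_norml => *; apply/andP; split; lra.
Qed.

(** Residual argument: (A - mu_j) v = (A - B) v for v = [psi j], so its norm is at most [eta]. In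
    the basis [phi], each component of v off [phi j] is stretched by at least g - eta, while the
    weight of these components is 1 minus the overlap. *)
Lemma eigenvector_overlap d (A B : 'M[C]_d) lam mu phi psi eta g j :
  q_sorted_eigendecomp A lam phi -> q_sorted_eigendecomp B mu psi ->
  bounded_by (A - B) eta -> eta <= g ->
  (forall k, k != j -> g <= `|lam j - lam k|) ->
  (g - eta) ^+ 2 * (1 - q_cmod2 (q_cdot (psi j) (phi j))) <= eta ^+ 2.
Proof.
move=> hA hB AB eta_g gap.
have lam_mu := weyl j hA hB AB.
case: hA hB => [_ phi_on Aphi] [_ psi_on Bpsi].
set v := psi j.
have v1 : q_vnorm v = 1 := vnorm_orthonormal psi_on j.
have res : \sum_k (lam k - mu j) ^+ 2 * q_cmod2 (q_cdot (phi k) v) <= eta ^+ 2.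
  have -> : \sum_k (lam k - mu j) ^+ 2 * q_cmod2 (q_cdot (phi k) v) =
      q_vnorm ((A - B) *m v) ^+ 2.
    have -> : (A - B) *m v = (A - (mu j)%:C%:M) *m v.
      by rewrite !mulmxBl Bpsi mul_scalar_mx.
    have Cphi k : (A - (mu j)%:C%:M) *m phi k = (lam k - mu j)%:C *: phi k.
      by rewrite mulmxBl Aphi mul_scalar_mx -scalerBl rmorphB.
    rewrite (mulmx_eigenbasis phi_on v Cphi) (sqr_vnorm_orthonormal_sum phi_on).
    by apply: eq_bigr => k _; rewrite cmod2M {2}/q_cmod2 /= expr0n addr0.
  rewrite ler_pXn2r ?nnegrE ?vnorm_ge0 //; last exact: le_trans (normr_ge0 _) lam_mu.
  by have := AB v; rewrite v1 mulr1.
have -> : q_cmod2 (q_cdot v (phi j)) = q_cmod2 (q_cdot (phi j) v).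
  by rewrite -cmod2_conj cdotC.
have := parseval phi_on v; rewrite v1 expr1n (bigD1 j) //= => {1}->.
rewrite addrAC subrr add0r; apply: le_trans res.
(* The nonnegative [j]-th term of the residual sum is discarded; the other terms are compared one by
   one. *)
rewrite mulr_sumr [X in _ <= X](bigD1 j) //= -[X in X <= _]add0r.
apply: lerD; first by rewrite mulr_ge0 ?sqr_ge0 ?cmod2_ge0.
apply: ler_sum => k kj; rewrite ler_wpM2r ?cmod2_ge0 //.
rewrite -[X in _ <= X]real_normK ?num_real //.
rewrite ler_pXn2r ?nnegrE ?subr_ge0 ?normr_ge0 // lerBlDr.
apply: le_trans (gap k kj) _; rewrite distrC.
(* Weyl's inequality bounds the second difference by [eta], which leaves |lam k - mu j| >= g -
   eta. *)
rewrite (_ : lam k - lam j = (lam k - mu j) - (lam j - mu j)); last by ring.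
by apply: le_trans (ler_normB _ _) _; rewrite lerD2l.
Qed.

(** Since the eigenvalues are sorted, the neighbour of [j] on the side of [k] is at least as close
    as [k]. That neighbour exists because [k] itself lies on that side, so [insub] succeeds. *)
Lemma q_gap_le d (lam : 'I_d -> R) j k :
  (forall i k : 'I_d, (i <= k)%N -> lam i <= lam k) ->
  k != j -> (q_gap lam j <= `|lam j - lam k|%:E)%E.
Proof.
move=> lam_le kj; rewrite /q_gap ge_min; apply/orP.
have [k_lt|j_lt|/val_inj e] := ltngtP k j; last by rewrite e eqxx in kj.
  left; have j_gt0 : (0 < j)%N := leq_ltn_trans (leq0n _) k_lt.
  rewrite j_gt0; case: insubP => [i _ ei|]; last first.
    by rewrite (leq_ltn_trans (leq_pred _) (ltn_ord j)).
  have ki : lam k <= lam i by apply: lam_le; rewrite ei -ltnS prednK.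
  have ij : lam i <= lam j by apply: lam_le; rewrite ei leq_pred.
  by rewrite lee_fin !ger0_norm ?subr_ge0 ?(le_trans ki) //; lra.
right; case: insubP => [i _ ei|]; last first.
  by rewrite (leq_ltn_trans j_lt (ltn_ord k)).
have ik : lam i <= lam k by apply: lam_le; rewrite ei.
have ji : lam j <= lam i by apply: lam_le; rewrite ei leqW.
rewrite lee_fin !(distrC (lam j)) !ger0_norm ?subr_ge0 ?(le_trans ji) //; lra.
Qed.

Lemma overlap_bound d (A B : 'M[C]_d) lam mu phi psi h j :
  q_sorted_eigendecomp A lam phi -> q_sorted_eigendecomp B mu psi ->
  bounded_by (A - B) (2 * h) -> 0 <= h -> ((2 * h)%:E < q_gap lam j)%E ->
  match q_gap lam j with
  | (g%:E)%E => 1 - pi * h / (g - 2 * h) <= q_cmod2 (q_cdot (psi j) (phi j))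
  | _ => 1 <= q_cmod2 (q_cdot (psi j) (phi j))
  end.
Proof.
move=> hA hB AB h0.
have gap k (kj : k != j) := q_gap_le (let: And3 h _ _ := hA in h) kj.
case: (q_gap lam j) gap => [g| |] gap //; last first.
  (* An infinite gap excludes every index other than [j], so Parseval has a single term and the
     overlap is 1. *)
  move=> _; case: (hA) => _ phi_on _; case: (hB) => _ psi_on _.
  rewrite -cmod2_conj cdotC.
  have := parseval phi_on (psi j); rewrite (vnorm_orthonormal psi_on) expr1n.
  rewrite (bigD1 j) //= big1 ?addr0 => [->//|k kj].
  by have := gap k kj; rewrite leNgt ltry.
rewrite lte_fin => hg; set x := q_cmod2 _.
have {}gap k : k != j -> g <= `|lam j - lam k| by move/gap; rewrite lee_fin.
have := eigenvector_overlap hA hB AB (ltW hg) gap; rewrite -/x => ovl.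
have s_gt0 : 0 < g - 2 * h by rewrite subr_gt0.
have x0 : 0 <= x := cmod2_ge0 _.
set s := g - 2 * h in ovl s_gt0 *.
have pi2 := @pi_ge2 R.
rewrite lerBlDr -lerBlDl.
rewrite ler_pdivlMr // mulrC.
(* At this threshold 4 h^2 and pi h s coincide. Below it, [ovl] suffices after multiplying by [s];
   above it, pi^2 >= 4 gives s <= pi h, and x >= 0 concludes. *)
have [hs|hs] := lerP (4 * h) (pi * s).
  rewrite -(ler_pM2l s_gt0) mulrA -expr2; apply: le_trans ovl _.
  by have := ler_wpM2l h0 hs; lra.
have : s <= pi * h.
  have h1 := ler_wpM2l (pi_ge0 R) (ltW hs).
  have h2 : 4 * s <= pi * (pi * s).
    by rewrite mulrA ler_wpM2r ?(ltW s_gt0) //; nra.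
  lra.
have := mulr_ge0 (ltW s_gt0) x0; lra.
Qed.

End EigenvaluePerturbation.

(** * Scalar exponential and logarithmic series on the unit circle *)

Section UnitCircleLog.
Set Implicit Arguments.
Unset Strict Implicit.
Import numFieldNormedType.Exports.
Local Open Scope classical_set_scope.
Local Open Scope ring_scope.
Local Open Scope complex_scope.
Context {R : realType}.
Local Notation C := R[i].
Implicit Types (x y : R) (z : C).

Lemma normc_le_ReIm z : normc z <= `|complex.Re z| + `|complex.Im z|.
Proof.
rewrite -(@ler_pXn2r _ 2) ?nnegrE ?normc_ge0 ?addr_ge0 ?normr_ge0 //.
rewrite sqr_normc_cmod2 /q_cmod2 sqrrD !real_normK ?num_real //.
by rewrite lerD2r lerDl mulrn_wge0 // mulr_ge0.
Qed.

Lemma ReIm_le_normc z : `|complex.Re z| <= normc z /\ `|complex.Im z| <= normc z.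
Proof.
split; rewrite -(@ler_pXn2r _ 2) ?nnegrE ?normc_ge0 ?normr_ge0 //.
  by rewrite sqr_normc_cmod2 /q_cmod2 real_normK ?num_real // lerDl sqr_ge0.
by rewrite sqr_normc_cmod2 /q_cmod2 real_normK ?num_real // lerDr sqr_ge0.
Qed.

Lemma increment_le (f df : R -> R) M x :
  (forall y, is_derive y 1 f (df y)) ->
  (forall y, `|y| <= `|x| -> `|df y| <= M) -> `|f x - f 0| <= M * `|x|.
Proof.
move=> fdf dfM.
have cf a b : {within `[a, b], continuous f}.
  apply: derivable_within_continuous => y _.
  by have [] := fdf y.
have [x_lt0|x_gt0|->] := ltrgtP x 0; last first.
- by rewrite subrr !normr0 mulr0.
- have [c + ->] := MVT x_gt0 (fun y _ => fdf y) (cf _ _).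
  rewrite in_itv /= => /andP[c0 cx]; rewrite subr0 normrM ler_wpM2r ?normr_ge0 //.
  by apply: dfM; rewrite !gtr0_norm // ltW.
- have [c + e] := MVT x_lt0 (fun y _ => fdf y) (cf _ _).
  rewrite in_itv /= => /andP[xc c0].
  rewrite distrC e sub0r normrM normrN ler_wpM2r ?normr_ge0 //.
  by apply: dfM; rewrite !ltr0_norm // lerN2 ltW.
Qed.

(** This is e^(-ix), given by components so that real calculus applies to it. *)
Definition expNi x : C := Complex (cos x) (- sin x).

(** The mean value bounds |sin x| <= |x| and |cos x - 1| <= x^2 give a squared modulus of at most
    1/16 + 1/256 < 1/9. The radius 1/3 leaves room for a perturbation of size 1/3 inside the ball of
    radius 2/3. *)
Lemma normc_expNi_sub1 x : `|x| <= 1 / 4 -> normc (expNi x - 1) <= 1 / 3.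
Proof.
move=> x4.
have sin_le y : `|sin y| <= `|y|.
  rewrite -[sin y]subr0 -(@sin0 R) -[X in _ <= X]mul1r.
  apply: (@increment_le sin cos) => z _.
  by rewrite ler_norml cos_geN1 cos_le1.
have cos_le : `|cos x - 1| <= `|x| * `|x|.
  rewrite -(@cos0 R); apply: (@increment_le cos (fun y => - sin y)) => z zx.
  by rewrite normrN; apply: le_trans (sin_le z) zx.
rewrite -(@ler_pXn2r _ 2) ?nnegrE ?normc_ge0 // sqr_normc_cmod2.
rewrite /q_cmod2 /= subr0 sqrrN -[X in X + _]real_normK ?num_real //.
rewrite -[X in _ + X]real_normK ?num_real //.
have := sin_le x; move: (normr_ge0 (sin x)) (normr_ge0 (cos x - 1)) (normr_ge0 x).
move: cos_le x4; move: `|sin x| `|cos x - 1| `|x| => s c y cy y4 s0 c0 y0 sy.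
have y2 : y * y <= 1 / 16 by nra.
have c2 : c * c <= 1 / 256 by nra.
have s2 : s * s <= 1 / 16 by nra.
by rewrite !expr2; lra.
Qed.

(** Componentwise differentiation along the real line, which lets the real mean value theorem act on
    each component. *)
Definition cderive (f : R -> C) x (z : C) : Prop :=
  is_derive x 1 (fun y => complex.Re (f y)) (complex.Re z) /\
  is_derive x 1 (fun y => complex.Im (f y)) (complex.Im z).

Lemma ReD z1 z2 : complex.Re (z1 + z2) = complex.Re z1 + complex.Re z2.
Proof. by case: z1 z2 => [? ?] [? ?]. Qed.

Lemma ImD z1 z2 : complex.Im (z1 + z2) = complex.Im z1 + complex.Im z2.
Proof. by case: z1 z2 => [? ?] [? ?]. Qed.

Lemma ReM z1 z2 : complex.Re (z1 * z2) =
  complex.Re z1 * complex.Re z2 - complex.Im z1 * complex.Im z2.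
Proof. by case: z1 z2 => [? ?] [? ?]. Qed.

Lemma ImM z1 z2 : complex.Im (z1 * z2) =
  complex.Re z1 * complex.Im z2 + complex.Im z1 * complex.Re z2.
Proof. by case: z1 z2 => [? ?] [? ?]. Qed.

Lemma cderive_cst z x : cderive (fun=> z) x 0.
Proof. by split; exact: is_derive_cst. Qed.

Lemma cderiveD f g x df dg : cderive f x df -> cderive g x dg ->
  cderive (fun y => f y + g y) x (df + dg).
Proof.
move=> [fr fi] [gr gi]; split.
  under eq_fun do rewrite ReD.
  by apply: is_derive_eq; rewrite ReD.
under eq_fun do rewrite ImD.
by apply: is_derive_eq; rewrite ImD.
Qed.

Lemma cderiveM f g x df dg : cderive f x df -> cderive g x dg ->
  cderive (fun y => f y * g y) x (df * g x + f x * dg).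
Proof.
move=> [fr fi] [gr gi]; split.
  under eq_fun do rewrite ReM.
  by apply: is_derive_eq; rewrite ReD !ReM /GRing.scale /=; ring.
under eq_fun do rewrite ImM.
by apply: is_derive_eq; rewrite ImD !ImM /GRing.scale /=; ring.
Qed.

Lemma cderive_eq f x a b : cderive f x a -> a = b -> cderive f x b.
Proof. by move=> h <-. Qed.

Lemma cderiveX f x df n : cderive f x df ->
  cderive (fun y => f y ^+ n.+1) x (n.+1%:R * (f x ^+ n * df)).
Proof.
move=> fdf; elim: n => [|n IH].
  by apply: cderive_eq fdf _; rewrite expr0 !mul1r.
under eq_fun do rewrite exprS.
apply: cderive_eq (cderiveM fdf IH) _.
by rewrite -(natr1 n.+1) exprS; ring.
Qed.

Lemma cderive_sum n (f : 'I_n -> R -> C) x df :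
  (forall k, cderive (f k) x (df k)) ->
  cderive (fun y => \sum_k f k y) x (\sum_k df k).
Proof.
elim: n f df => [|n IH] f df fdf.
  under eq_fun do rewrite big_ord0.
  by rewrite big_ord0; exact: cderive_cst.
under eq_fun do rewrite big_ord_recl.
by rewrite big_ord_recl; apply: cderiveD => //; apply: IH => k.
Qed.

Lemma cderive_expNi x : cderive expNi x (- 'i * expNi x).
Proof.
split; apply: is_derive_eq.
  by rewrite ReM /=; ring.
by rewrite ImM /=; ring.
Qed.

Definition log_sum n z : C :=
  \sum_(k < n) ((-1) ^+ k / k.+1%:R) * (z - 1) ^+ k.+1.

(* The derivative of [log_sum n] is a geometric sum, so that the error
   [log_sum n (expNi x) + i x] has derivative [i (1 - expNi x)^n]. *)
Lemma cderive_log_error n x :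
  cderive (fun y => log_sum n (expNi y) + 'i * y%:C) x ('i * (1 - expNi x) ^+ n).
Proof.
have idx : cderive (fun y => y%:C : C) x 1.
  by split; [exact: is_derive_id|exact: is_derive_cst].
have lin : cderive (fun y => 'i * y%:C : C) x 'i.
  by apply: cderive_eq (cderiveM (cderive_cst 'i x) idx) _; rewrite mul0r add0r mulr1.
have pw (k : 'I_n) := cderiveM (cderive_cst ((-1) ^+ k / k.+1%:R) x)
  (cderiveX k (cderiveD (cderive_expNi x) (cderive_cst (-1) x))).
apply: cderive_eq (cderiveD (cderive_sum pw) lin) _.
have -> : (1 - expNi x) ^+ n = 1 - (\sum_(k < n) (1 - expNi x) ^+ k) * expNi x.
  have := subrX1 (1 - expNi x) n.
  rewrite (_ : 1 - expNi x - 1 = - expNi x); last by ring.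
  by move=> h; rewrite mulrC -[X in 1 - X]opprK -mulNr -h; ring.
transitivity (\sum_(k < n) - 'i * ((1 - expNi x) ^+ k * expNi x) + 'i : C).
  congr (_ + _); apply: eq_bigr => k _.
  have k1 : (k.+1%:R : C) != 0 by rewrite pnatr_eq0.
  by rewrite -[1 - expNi x]opprB [(- (_ - _)) ^+ k]exprNn; field.
by rewrite -mulr_sumr -mulr_suml; ring.
Qed.

(** The error vanishes at 0 and its derivative has modulus |1 - e^(-iy)|^n <= (1/3)^n between 0 and
    x, so integrating it along the real line identifies the logarithm of e^(-ix) with an explicit
    rate. *)
Lemma log_sum_expNi n x : `|x| <= 1 / 4 ->
  normc (log_sum n (expNi x) + 'i * x%:C) <= (1 / 3) ^+ n.
Proof.
move=> x4; set F := fun y => log_sum n (expNi y) + 'i * y%:C.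
have F0 : F 0 = 0.
  rewrite /F /log_sum big1 ?mulr0 ?addr0 // => k _.
  rewrite /expNi cos0 sin0 oppr0 subrr exprS mul0r mulr0 //.
have dF y : cderive F y ('i * (1 - expNi y) ^+ n) := cderive_log_error n y.
have dF_le y : `|y| <= `|x| -> normc ('i * (1 - expNi y) ^+ n) <= (1 / 3) ^+ n.
  move=> yx; rewrite normcM normcX -[1 - _]opprB normcN.
  rewrite (_ : normc 'i = 1) ?[1 * normc _ ^+ n]mul1r; last by rewrite /= expr0n add0r expr1n sqrtr1.
  apply: lerXn2r; rewrite ?nnegrE ?normc_ge0 ?divr_ge0 //.
  exact/normc_expNi_sub1/(le_trans yx).
have r0 : 0 <= (1 / 3 : R) ^+ n by rewrite exprn_ge0.
apply: le_trans (normc_le_ReIm _) _.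
have hr : `|complex.Re (F x)| <= (1 / 3) ^+ n * `|x|.
  have := @increment_le (fun y => complex.Re (F y)) _ ((1 / 3) ^+ n) x
    (fun y => (dF y).1).
  rewrite F0 subr0; apply => y yx.
  by apply: le_trans (dF_le y yx); exact: (ReIm_le_normc _).1.
have hi : `|complex.Im (F x)| <= (1 / 3) ^+ n * `|x|.
  have := @increment_le (fun y => complex.Im (F y)) _ ((1 / 3) ^+ n) x
    (fun y => (dF y).2).
  rewrite F0 subr0; apply => y yx.
  by apply: le_trans (dF_le y yx); exact: (ReIm_le_normc _).2.
(* Adding the two components gives the factor 2 |x| <= 1/2. *)
rewrite -/(F x); nra.
Qed.

Definition exp_sum n z : C := \sum_(k < n) (k`!%:R)^-1 * z ^+ k.

(** The parity indicators are those of [cos_coeff] and [sin_coeff], so the exponential series splits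
    into the cosine and sine series. *)
Lemma expNi_term n : (- 'i : C) ^+ n =
  Complex ((~~ odd n)%:R * (-1) ^+ n./2) (- ((odd n)%:R * (-1) ^+ n./2)).
Proof.
elim: n => [|n IH]; first by rewrite expr0 /= mul1r mul0r oppr0.
rewrite exprS IH /= uphalf_half; simpc; case: (odd n) => /=.
  by rewrite !(mul1r, mul0r) add1n exprS; congr Complex; ring.
by rewrite !(mul1r, mul0r); congr Complex; ring.
Qed.

Lemma exp_sum_Ni n x :
  exp_sum n (- 'i * x%:C) = Complex (series (cos_coeff x) n) (- series (sin_coeff x) n).
Proof.
rewrite /series /= !big_mkord /exp_sum.
elim: n => [|n IH]; first by rewrite !big_ord0 oppr0.
rewrite !big_ord_recr /= IH exprMn expNi_term -rmorphXn.
rewrite -(rmorph_nat (real_complex R)) -fmorphV /cos_coeff /sin_coeff /=; simpc.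
congr Complex; rewrite /=; first by rewrite -exprnP; ring.
congr (_ - _); case odd_n: (odd n); last by rewrite !mul0r mulr0.
(* [sin_coeff] carries the sign exponent [n.-1./2], which agrees with [n./2] for odd [n]. *)
have -> : n.-1./2 = n./2.
  by rewrite -(odd_double_half n) odd_n add1n /= doubleK uphalf_double.
by ring.
Qed.

Lemma exp_sum_expNi x e : 0 < e ->
  exists N, forall n, (N <= n)%N -> normc (exp_sum n (- 'i * x%:C) - expNi x) < e.
Proof.
move=> e0.
have cos_cvg : (series (cos_coeff x) @ \oo --> cos x)%classic.
  by rewrite unlock; exact: is_cvg_series_cos_coeff.
have sin_cvg : (series (sin_coeff x) @ \oo --> sin x)%classic.
  by rewrite unlock; exact: is_cvg_series_sin_coeff.
have e2 : 0 < e / 2 by rewrite divr_gt0.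
have /cvgrPdist_lt /(_ _ e2) [Nc _ hc] := cos_cvg.
have /cvgrPdist_lt /(_ _ e2) [Ns _ hs] := sin_cvg.
exists (maxn Nc Ns) => n; rewrite geq_max => /andP[nc ns].
rewrite exp_sum_Ni; apply: le_lt_trans (normc_le_ReIm _) _.
rewrite /= -opprD normrN distrC [X in _ + X]distrC.
have := hc n nc; have := hs n ns => /= h1 h2; lra.
Qed.

End UnitCircleLog.

(** * Matrix exponential and logarithm, and the distance from the logarithm to -iHt *)

Section EffectiveHamiltonian.
Set Implicit Arguments.
Unset Strict Implicit.
Import numFieldNormedType.Exports.
Context {R : realType}.
Local Notation C := R[i].
Implicit Types (d : nat).

Lemma bounded_by_closed d (A : 'M[C]_d) c :
  (forall e, 0 < e -> bounded_by A (c + e)) -> bounded_by A c.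
Proof.
move=> h v; apply/ler_addgt0Pr => e e0.
have v1 : 0 < q_vnorm v + 1 by rewrite ltr_pwDr ?vnorm_ge0.
apply: le_trans (h (e / (q_vnorm v + 1)) _ v) _; first by rewrite divr_gt0.
rewrite mulrDl lerD2l -mulrA ler_piMr ?(ltW e0) // mulrC ler_pdivrMr // mul1r.
by rewrite lerDl.
Qed.

(** By Parseval, scalar estimates on the spectrum transfer to any matrix diagonal in an orthonormal
    basis, even with complex eigenvalues. *)
Lemma bounded_by_eigenbasis d (A : 'M[C]_d) psi (a : 'I_d -> C) c :
  q_orthonormal psi -> (forall k, A *m psi k = a k *: psi k) ->
  0 <= c -> (forall k, normc (a k) <= c) -> bounded_by A c.
Proof.
move=> psi_on Apsi c0 ac v; rewrite (mulmx_eigenbasis psi_on v Apsi).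
rewrite -(@ler_pXn2r _ 2) ?nnegrE ?mulr_ge0 ?vnorm_ge0 //.
rewrite (sqr_vnorm_orthonormal_sum psi_on) exprMn (parseval psi_on) mulr_sumr.
apply: ler_sum => k _; rewrite cmod2M ler_wpM2r ?cmod2_ge0 // -sqr_normc_cmod2.
by rewrite ler_pXn2r ?nnegrE ?normc_ge0.
Qed.

Lemma mulmx_pow_eigenvector d (A : 'M[C]_d) (a : C) (v : 'cV[C]_d) k :
  A *m v = a *: v -> A ^+ k *m v = a ^+ k *: v.
Proof.
move=> Av; elim: k => [|k IH]; first by rewrite !expr0 mul1mx scale1r.
by rewrite exprSr -mulmxA Av -scalemxAr IH scalerA -exprS.
Qed.

Lemma mulmx_series_eigenvector d (A : 'M[C]_d) (a : C) (v : 'cV[C]_d) (c : nat -> C)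
    (p : nat -> nat) n :
  A *m v = a *: v ->
  (\sum_(k < n) c k *: A ^+ p k) *m v = (\sum_(k < n) c k * a ^+ p k) *: v.
Proof.
move=> Av; rewrite mulmx_suml scaler_suml; apply: eq_bigr => k _.
by rewrite -scalemxAl (mulmx_pow_eigenvector _ Av) scalerA.
Qed.

(** [E] is known only as a limit, so both sides are compared with a common partial sum applied to
    [v], and their distance is shown to be below every positive [e]. *)
Lemma expm_eigenvector d (H E : 'M[C]_d) (t h : R) (v : 'cV[C]_d) :
  q_is_expm ((- (Complex 0 1) * t%:C) *: H) E -> H *m v = h%:C *: v ->
  E *m v = expNi (h * t) *: v.
Proof.
move=> exE Hv.
have Av : ((- (Complex 0 1) * t%:C) *: H) *m v = (- 'i * (h * t)%:C) *: v.
  by rewrite -scalemxAl Hv scalerA [h * t]mulrC rmorphM mulrA.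
apply/eqP; rewrite -subr_eq0; apply/eqP/vnorm_eq0/le_anti; rewrite vnorm_ge0 andbT.
apply/ler_addgt0Pr => e e0; rewrite add0r.
(* The factor 2 shares [e] between the two errors; the added 1 keeps the denominator positive when
   [v] is zero. *)
have v1 : 0 < 2 * (q_vnorm v + 1) by rewrite mulr_gt0 // ltr_pwDr ?vnorm_ge0.
have e1 : 0 < e / (2 * (q_vnorm v + 1)) by rewrite divr_gt0.
have [N1 hN1] := exE _ e1.
have [N2 hN2] := exp_sum_expNi (h * t) e1.
pose n := maxn N1 N2.
have /ltW h1 := hN1 n (leq_maxl _ _); have /ltW h2 := hN2 n (leq_maxr _ _).
set S := \sum_(k < n) _ in h1.
have Sv : S *m v = exp_sum n (- 'i * (h * t)%:C) *: v.
  exact: (mulmx_series_eigenvector (fun k => (k`!%:R)^-1) id n Av).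
have -> : E *m v - expNi (h * t) *: v =
    (exp_sum n (- 'i * (h * t)%:C) - expNi (h * t)) *: v - (S - E) *m v.
  by rewrite mulmxBl Sv scalerBl opprB [RHS]addrC addrA subrK.
apply: le_trans (vnormB _ _) _; rewrite vnormZ.
have b1 := bounded_byW h1 (@bounded_by_opnorm _ _ _) v.
have b2 := ler_wpM2r (vnorm_ge0 v) h2.
apply: le_trans (lerD b2 b1) _.
rewrite -[X in _ <= X](divfK (lt0r_neq0 v1)).
by move: e1; set x := e / _ => x0; lra.
Qed.

Definition log_sum_mx n d (M : 'M[C]_d) : 'M[C]_d :=
  \sum_(k < n) ((-1) ^+ k / k.+1%:R) *: (M - 1%:M) ^+ k.+1.

Lemma log_sum_mx_eigenvector n d (M : 'M[C]_d) (a : C) (v : 'cV[C]_d) :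
  M *m v = a *: v -> log_sum_mx n M *m v = log_sum n a *: v.
Proof.
move=> Mv; have Mv1 : (M - 1%:M) *m v = (a - 1) *: v.
  by rewrite mulmxBl mul1mx Mv scalerBl scale1r.
exact: (mulmx_series_eigenvector (fun k => (-1) ^+ k / k.+1%:R) S n Mv1).
Qed.

(** In the term of degree k+1, the factor k+1 from telescoping cancels the coefficient 1/(k+1). What
    remains is the geometric series of ratio 2/3, whose sum is the constant 3, uniformly in [n]. *)
Lemma log_sum_mx_lipschitz n d (M N : 'M[C]_d) e : 0 <= e ->
  bounded_by (M - 1%:M) (2 / 3) -> bounded_by (N - 1%:M) (2 / 3) ->
  bounded_by (M - N) e -> bounded_by (log_sum_mx n M - log_sum_mx n N) (3 * e).
Proof.
move=> e0 M1 N1 MN; rewrite /log_sum_mx -sumrB.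
have geo : \sum_(k < n) (2 / 3) ^+ k * e <= 3 * e.
  have -> : \sum_(k < n) (2 / 3) ^+ k * e = 3 * e - 3 * (2 / 3) ^+ n * e.
    elim: n => [|n IH]; first by rewrite big_ord0 expr0; ring.
    by rewrite big_ord_recr /= IH exprS; field.
  by rewrite gerBl !mulr_ge0 ?exprn_ge0 // divr_ge0.
apply: bounded_byW geo _; apply: bounded_by_sum => k.
rewrite -scalerBr.
have -> : (2 / 3) ^+ k * e =
    normc ((-1) ^+ k / k.+1%:R : C) * (k.+1%:R * ((2 / 3) ^+ k * e)).
  rewrite normcM normcV normcX normcN normc1 expr1n mul1r normc_nat.
  by rewrite mulKf // pnatr_eq0.
apply: bounded_byZ; apply: bounded_by_subX e0 M1 N1 _; first by rewrite divr_ge0.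
by rewrite opprB addrA subrK.
Qed.

(** The logarithm of [E] is -iHt, read off on an eigenbasis of [H], and the Lipschitz bound carries
    this from [E] to [U] at a cost of 3e. *)
Lemma logm_near_expm d (H E U L : 'M[C]_d) (t e : R) :
  q_hermitian H -> 0 < t -> 4 * q_opnorm H * t <= 1 ->
  q_is_expm ((- (Complex 0 1) * t%:C) *: H) E ->
  0 <= e -> e <= 1 / 3 -> bounded_by (U - E) e -> q_is_logm U L ->
  bounded_by (L + ('i * t%:C) *: H) (3 * e).
Proof.
move=> hH t0 Ht exE e0 e3 UE logL.
have [h [chi [chi_on Hchi]]] := hermitian_eigenbasis hH.
have ht k : `|h k * t| <= 1 / 4.
  have : `|h k| <= q_opnorm H.
    have := bounded_by_opnorm H (chi k).
    by rewrite Hchi vnormZ normc_real (vnorm_orthonormal chi_on) !mulr1.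
  rewrite normrM (gtr0_norm t0) => hk.
  by have := ler_wpM2r (ltW t0) hk; lra.
have Echi k := expm_eigenvector exE (Hchi k).
have E1 : bounded_by (E - 1%:M) (1 / 3).
  apply: (bounded_by_eigenbasis (a := fun k => expNi (h k * t) - 1) chi_on) => //.
    by move=> k; rewrite mulmxBl mul1mx Echi scalerBl scale1r.
  by move=> k; exact: normc_expNi_sub1.
have U1 : bounded_by (U - 1%:M) (2 / 3).
  rewrite (_ : U - 1%:M = (U - E) + (E - 1%:M)); last by rewrite addrA subrK.
  by apply: bounded_byW (bounded_byD UE E1); lra.
have {}E1 : bounded_by (E - 1%:M) (2 / 3) by apply: bounded_byW E1; lra.
have SE n : bounded_by (log_sum_mx n E + ('i * t%:C) *: H) ((1 / 3) ^+ n).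
  apply: (bounded_by_eigenbasis
    (a := fun k => log_sum n (expNi (h k * t)) + 'i * (h k * t)%:C) chi_on).
  - move=> k; rewrite mulmxDl (log_sum_mx_eigenvector n (Echi k)) -scalemxAl Hchi.
    by rewrite scalerA scalerDl -mulrA -rmorphM [t * _]mulrC.
  - by rewrite exprn_ge0.
  - by move=> k; exact: log_sum_expNi.
apply: bounded_by_closed => eta eta0.
have eta2 : 0 < eta / 2 by rewrite divr_gt0.
have [N1 hN1] := logL _ eta2.
have : ((fun n => (1 / 3 : R) ^+ n) @ \oo --> (0 : R))%classic.
  by apply: cvg_expr; rewrite ger0_norm //; lra.
move=> /cvgrPdist_lt /(_ _ eta2) [N2 _ hN2].
pose n := maxn N1 N2.
have /ltW h1 := hN1 n (leq_maxl _ _).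
have := hN2 n (leq_maxr _ _); rewrite /= sub0r normrN ger0_norm ?exprn_ge0 // => /ltW h2.
(* Three errors: truncation of the series at [U], at most eta/2; passage from [U] to [E], at most
   3e; truncation at [E], at most (1/3)^n <= eta/2. *)
rewrite (_ : L + _ = - (log_sum_mx n U - L) + (log_sum_mx n U - log_sum_mx n E)
    + (log_sum_mx n E + ('i * t%:C) *: H)); last first.
  by rewrite opprB !addrA subrK addrNK.
have b1 := bounded_byN (bounded_byW h1 (@bounded_by_opnorm _ _ _)).
have b2 := log_sum_mx_lipschitz n e0 U1 E1 UE.
have b3 := bounded_byW h2 (SE n).
apply: bounded_byW (bounded_byD (bounded_byD b1 b2) b3).
by rewrite addrAC addrC lerD2l -splitr.
Qed.

End EffectiveHamiltonian.

Theorem theorem4 (R : realType) (d : nat) (H0 Hint : 'M[(complex R)]_d)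
  (lam0 : 'I_d -> R) (phi0 : 'I_d -> 'cV[(complex R)]_d)
  (t eps : R) (Ut E L : 'M[(complex R)]_d)
  (lamt : 'I_d -> R) (phit : 'I_d -> 'cV[(complex R)]_d) (j : 'I_d) :
  q_hermitian H0 -> q_hermitian Hint ->
  q_sorted_eigendecomp H0 lam0 phi0 ->
  0 < t -> 4 * q_opnorm (H0 + Hint) * t <= 1 ->
  0 <= eps -> eps <= q_opnorm Hint ->
  q_is_expm ((- (Complex 0 1) * t%:C) *: (H0 + Hint)) E ->
  q_unitary Ut ->
  q_opnorm (Ut - E) <= t * eps / 9 -> t * eps / 9 <= 1 / 3 ->
  q_is_logm Ut L ->
  q_sorted_eigendecomp ((Complex 0 1 / t%:C) *: L) lamt phit ->
  ((2 * q_opnorm Hint)%:E < q_gap lam0 j)%E ->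
  match q_gap lam0 j with
  | (g%:E)%E => 1 - pi * q_opnorm Hint / (g - 2 * q_opnorm Hint)
                  <= q_cmod2 (q_cdot (phit j) (phi0 j))
  | _ => 1 <= q_cmod2 (q_cdot (phit j) (phi0 j))
  end.
Proof.
move=> hH0 hHint dH0 t0 Ht eps0 eps_h exE _ UE te3 logL dHt gap.
have hH : q_hermitian (H0 + Hint).
  by rewrite /q_hermitian /q_adj linearD map_mxD [X in X + _]hH0 [X in _ + X]hHint.
have d0 : 0 <= t * eps / 9 by rewrite divr_ge0 ?mulr_ge0 ?(ltW t0).
have bUE := bounded_byW UE (@bounded_by_opnorm _ _ _).
have near := logm_near_expm hH t0 Ht exE d0 te3 bUE logL.
apply: overlap_bound dH0 dHt _ (opnorm_ge0 Hint) gap.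
have tC : t%:C != 0 :> R[i] by rewrite fmorph_eq0 gt_eqF.
(* Since (i/t)(it) = -1, the term [(i t) H] contributes [H0 + Hint], and subtracting [Hint] leaves
   [H0]. *)
have -> : H0 - (Complex 0 1 / t%:C) *: L =
    - ((Complex 0 1 / t%:C) *: (L + ('i * t%:C) *: (H0 + Hint))) - Hint.
  rewrite scalerDr scalerA (_ : _ * ('i * _) = -1); last first.
    rewrite mulrACA [_^-1 * _]mulVf // mulr1 -[Complex 0 1]/('i : R[i]).
    by rewrite -expr2 sqr_i.
  by rewrite scaleN1r opprB [RHS]addrAC addrK.
have b := bounded_byD (bounded_byN (bounded_byZ (Complex 0 1 / t%:C) near))
  (bounded_byN (@bounded_by_opnorm _ _ Hint)).
apply: bounded_byW b.
have -> : normc (Complex 0 1 / t%:C) = t^-1.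
  rewrite normcM normcV normc_real gtr0_norm // -[RHS]mul1r; congr (_ * _).
  by rewrite /= expr0n add0r expr1n sqrtr1.
(* The factor 1/t cancels the [t] in the error of [Ut], and with [eps] at most the norm of [Hint]
   the total is at most 4/3 of that norm, within the allowed factor 2. *)
have -> : t^-1 * (3 * (t * eps / 9)) = eps / 3 by field; rewrite gt_eqF.
have := opnorm_ge0 Hint; clear - eps0 eps_h; lra.
Qed.
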